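(* Let $\beta$ be any positive root and let $\beta=s_{i_r}\cdots s_{i_2}s_{i_1}\alpha_j$ be a positive expression for $\beta$. Then the set of shards of $\beta^{\perp}$ is the set of polyhedral cones of the form $\sigma_{i_r}^{\pm_r}\cdots\sigma_{i_2}^{\pm_2}\sigma_{i_1}^{\pm_1}(\alpha_j^{\perp})$ which are of dimension $n-1$, where the signs $\pm_1,\pm_2,\dots,\pm_r\in\{+,-\}$ may be chosen independently.
   Context: Root system. Let $d_1,\dots,d_n$ be positive integers and let $A=(A_{ij})$ be an $n\times n$ integer matrix with $A_{ii}=2$, $d_iA_{ij}=d_jA_{ji}$, and $A_{ij}\le 0$ for $i\ne j$ (a crystallographic symmetrizable Cartan matrix). Let $V$ be the real vector space with basis $\alpha_1,\dots,\alpha_n$, with symmetric bilinear form $(\alpha_i,\alpha_j)=d_iA_{ij}$; put $\alpha_i^\vee=d_i^{-1}\alpha_i$ and $s_i(x)=x-(\alpha_i^\vee,x)\alpha_i$. Let $W\subset \mathrm{GL}(V)$ be generated by the $s_i$. The set of (real) roots is $\Phi=\{w\alpha_i: w\in W,\ 1\le i\le n\}$; every root is a nonnegative (positive root, $\Phi^+$) or nonpositive (negative root) combination of the $\alpha_i$. Let $V^*$ be the dual space with pairing $\langle\ ,\ \rangle$, with $W$ acting by $\langle w\eta,w\beta\rangle=\langle\eta,\beta\rangle$, and for $\beta\in V$ put $\beta^\perp=\{\theta\in V^*:\langle\theta,\beta\rangle=0\}$. Positive expressions. A positive expression for a positive root $\beta$ is a formula $\beta=s_{i_r}\cdots s_{i_1}\alpha_j$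 ($r\ge 0$) such that for all $1\le k\le r$, $s_{i_k}s_{i_{k-1}}\cdots s_{i_1}\alpha_j-s_{i_{k-1}}\cdots s_{i_1}\alpha_j\in\mathbb R_{>0}\alpha_{i_k}$. Shards. A rank two subsystem is a subset $R\subset\Phi$ such that $\mathrm{Span}_{\mathbb R}R$ is two dimensional and $R=\Phi\cap \mathrm{Span}_{\mathbb R}R$. There are two roots $\beta_1,\beta_2\in R\cap\Phi^+$, the fundamental roots of $R$, such that every root of $R\cap\Phi^+$ is a nonnegative linear combination of $\beta_1,\beta_2$. For $\beta\in\Phi^+$, $R$ cuts $\beta^\perp$ if $\beta\in R$ and $\beta$ is not a fundamental root of $R$. Put $R^\perp=\{\theta\in V^*:\langle\theta,\gamma\rangle=0\ \forall\gamma\in R\}$. Only finitely many $R$ cut a given $\beta^\perp$. The shards of $\beta^\perp$ are the closures of the connected components of $\beta^\perp\setminus\bigcup_{R\text{ cuts }\beta^\perp}R^\perp$. Cone operations. For a convex polyhedral cone $K\subseteq V^*$: $\sigma_i^+(K)=s_i(K\cap\{x:\langle x,\alpha_i\rangle\ge0\})$ and $\sigma_i^-(K)=s_i(K\cap\{x:\langle x,\alpha_i\rangle\le0\})$. *)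

(* Defs.v *)
From HB Require Import structures.
From mathcomp Require Import all_boot all_order all_algebra.
From mathcomp Require Import all_classical all_reals all_analysis.

Set Implicit Arguments.
Unset Strict Implicit.
Unset Printing Implicit Defensive.

Import Order.TTheory GRing.Theory Num.Theory.
Import numFieldNormedType.Exports.

Local Open Scope classical_set_scope.
Local Open Scope ring_scope.

Definition sym_cartan (n : nat) (d : 'I_n -> nat) (A : 'M[int]_n) : Prop :=
  [/\ forall i, (0 < d i)%N,
      forall i, A i i = 2,
      forall i j, (d i)%:Z * A i j = (d j)%:Z * A j i
    & forall i j, i != j -> A i j <= 0].

(* V is the space 'cV[R]_n of coordinates in the basis of simple roots, and   *)
(* V^* is the space 'rV[R]_n of coordinates in the dual basis.  An element w  *)
(* of GL(V) is a unit of 'M[R]_n, acting on V by x |-> w *m x.                *)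
Section RootSystem.
Variables (R : realType) (n : nat) (d : 'I_n -> nat) (A : 'M[int]_n).

Definition simple_root (i : 'I_n) : 'cV[R]_n := delta_mx i 0.

Definition gram : 'M[R]_n := \matrix_(i, j) ((d i)%:R * (A i j)%:~R).

Definition bform (x y : 'cV[R]_n) : R := (x^T *m gram *m y) 0 0.

Definition simple_coroot (i : 'I_n) : 'cV[R]_n :=
  ((d i)%:R)^-1 *: simple_root i.

Definition refl (i : 'I_n) : 'M[R]_n :=
  1%:M - simple_root i *m ((simple_coroot i)^T *m gram).

Lemma reflE (i : 'I_n) (x : 'cV[R]_n) :
  refl i *m x = x - bform (simple_coroot i) x *: simple_root i.
Proof.
rewrite /refl mulmxBl mul1mx -(mulmxA _ _ x); congr (_ - _).
by rewrite [_ *m x]mx11_scalar mul_mx_scalar.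
Qed.

Lemma bform_simple (i j : 'I_n) :
  bform (simple_root i) (simple_root j) = (d i)%:R * (A i j)%:~R.
Proof.
rewrite /bform /simple_root trmx_delta -mulmxA -colE -rowE.
by rewrite !mxE.
Qed.

Inductive weyl : 'M[R]_n -> Prop :=
| weyl_one : weyl 1%:M
| weyl_refl i : weyl (refl i)
| weyl_mul w1 w2 : weyl w1 -> weyl w2 -> weyl (w1 *m w2)
| weyl_inv w : weyl w -> weyl (invmx w).

Definition roots : set 'cV[R]_n :=
  [set x | exists w i, weyl w /\ x = w *m simple_root i].

Definition pos_roots : set 'cV[R]_n :=
  roots `&` [set x | forall i, 0 <= x i 0].

Definition pairing (theta : 'rV[R]_n) (x : 'cV[R]_n) : R :=
  (theta *m x) 0 0.

Definition dual_act (w : 'M[R]_n) (theta : 'rV[R]_n) : 'rV[R]_n :=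
  theta *m invmx w.

Lemma dual_actP (w : 'M[R]_n) (theta : 'rV[R]_n) (x : 'cV[R]_n) :
  w \in unitmx -> pairing (dual_act w theta) (w *m x) = pairing theta x.
Proof. by move=> uw; rewrite /pairing /dual_act mulmxA mulmxKV. Qed.

(* refl i is a genuine unit, so invmx does not take its default value.        *)
Lemma refl_unit (i : 'I_n) : sym_cartan d A -> refl i \in unitmx.
Proof.
case=> d_gt0 Aii _ _.
suff e : refl i *m refl i = 1%:M by case: (mulmx1_unit e).
have c2 : bform (simple_coroot i) (simple_root i) = 2.
  rewrite /bform /simple_coroot linearZ /= -!scalemxAl mxE -/(bform _ _).
  by rewrite bform_simple Aii mulrA mulVf ?mul1r // pnatr_eq0 -lt0n.
have eN : refl i *m simple_root i = - simple_root i.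
  by rewrite reflE c2 scaler_nat mulr2n opprD addrA subrr add0r.
rewrite [X in _ *m X]/refl mulmxBr mulmx1 (mulmxA (refl i)) eN mulNmx opprK.
by rewrite /refl subrK.
Qed.

Definition perp (x : 'cV[R]_n) : set 'rV[R]_n :=
  [set theta | pairing theta x = 0].

Definition set_perp (S : set 'cV[R]_n) : set 'rV[R]_n :=
  [set theta | forall x, S x -> pairing theta x = 0].

(* w lists the indices i_1, ..., i_r in order of application.                 *)
Definition apply_refls (w : seq 'I_n) (x : 'cV[R]_n) : 'cV[R]_n :=
  foldl (fun y i => refl i *m y) x w.

Definition positive_expression (beta : 'cV[R]_n) (w : seq 'I_n) (j : 'I_n) :
    Prop :=
  beta = apply_refls w (simple_root j) /\
  forall k, (k < size w)%N ->
    exists2 c : R, 0 < c &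
      apply_refls (take k.+1 w) (simple_root j)
      - apply_refls (take k w) (simple_root j)
      = c *: simple_root (nth j w k).

Definition span_of (vT : vectType R) (S : set vT) (U : {vspace vT}) : Prop :=
  (forall x, S x -> x \in U) /\
  forall U' : {vspace vT}, (forall x, S x -> x \in U') -> (U <= U')%VS.

Definition span_dim (vT : vectType R) (S : set vT) (m : nat) : Prop :=
  exists2 U : {vspace vT}, span_of S U & \dim U = m.

Definition rank_two_subsystem (S : set 'cV[R]_n) : Prop :=
  exists U : {vspace 'cV[R]_n},
    [/\ span_of S U, \dim U = 2 & S = roots `&` [set x | x \in U]].

Definition fundamental_pair (S : set 'cV[R]_n) (b1 b2 : 'cV[R]_n) : Prop :=
  [/\ (S `&` pos_roots) b1, (S `&` pos_roots) b2
    & forall x, (S `&` pos_roots) x ->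
        exists c1 c2 : R, [/\ 0 <= c1, 0 <= c2 & x = c1 *: b1 + c2 *: b2]].

Definition fundamental_root (S : set 'cV[R]_n) (b : 'cV[R]_n) : Prop :=
  exists b1 b2, fundamental_pair S b1 b2 /\ (b = b1 \/ b = b2).

Definition cuts (S : set 'cV[R]_n) (beta : 'cV[R]_n) : Prop :=
  [/\ rank_two_subsystem S, S beta & ~ fundamental_root S beta].

Definition shards (beta : 'cV[R]_n) : set (set 'rV[R]_n) :=
  let X := perp beta `\` \bigcup_(S in [set S | cuts S beta]) set_perp S in
  [set closure (connected_component X theta) | theta in X].

(* The sign + is encoded by true.                                             *)
Definition half_space (e : bool) (i : 'I_n) : set 'rV[R]_n :=
  [set theta | if e then 0 <= pairing theta (simple_root i)
               else pairing theta (simple_root i) <= 0].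

Definition sigma (e : bool) (i : 'I_n) (K : set 'rV[R]_n) : set 'rV[R]_n :=
  dual_act (refl i) @` (K `&` half_space e i).

Definition sigmas (w : seq 'I_n) (es : seq bool) (K : set 'rV[R]_n) :
    set 'rV[R]_n :=
  foldl (fun L p => sigma p.2 p.1 L) K (zip w es).

End RootSystem.

(* Main.v *)
Require Import Defs.
From mathcomp Require Import all_boot all_order all_algebra.
From mathcomp Require Import all_classical all_reals all_analysis.
From mathcomp Require Import ring lra zify.

Import Order.TTheory GRing.Theory Num.Theory.
Import numFieldNormedType.Exports.

Local Open Scope classical_set_scope.
Local Open Scope ring_scope.

Set Implicit Arguments.
Unset Strict Implicit.
Unset Printing Implicit Defensive.

(** The hyperplane [perp beta] is reached from [perp (simple_root R j)] by
    applying the reflections of the positive expression one after the other,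
    and both sides of the theorem obey the same rule at each step: cut along
    the hyperplane of [simple_root i], then apply [refl i].

    For the shards, let [x] be a root on the way and
    [y = refl i *m x = x + c *: simple_root i] with [0 < c].  The reflection
    permutes the positive roots that are not multiples of [simple_root i], so
    it matches the rank two subsystems without [simple_root i] that cut the
    hyperplane of [x] with those that cut the hyperplane of [y]
    ([cuts_refl]).  A subsystem containing [simple_root i] and [y] lies in the
    plane they span, and there [y] is not fundamental, because
    [x = y - c *: simple_root i] is again positive ([span_cuts]).  So passing
    from [x] to [y] adds exactly the cut along [perp (simple_root i)]
    ([shard_interior_refl]).  At the start there is no cut, as a simple root
    is fundamental in each rank two subsystem containing it
    ([simple_not_cut]).  Hence the shards are the closures of the components
    of [perp beta] minus finitely many hyperplanes, with normals
    [wall_normals].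

    For the cones, [sigma] adds one weak inequality and reflects, so the
    choices of signs give the cones in [perp beta] defined by one weak
    inequality for each of these same normals ([sigmas_perp]).

    The two families are compared in [arrangement_component_closures].  A
    sign choice whose strict inequalities have a solution gives a component,
    whose closure is the cone of the weak inequalities, and this cone spans
    [perp beta].  If the strict inequalities have no common solution, some
    normal vanishes on the whole cone: otherwise a sum of points, one
    positive on each normal, would be a solution.  Such a cone is too small,
    since no wall normal is a multiple of [beta].

    The input from root systems is that a root has coordinates of constant
    sign ([root_sign]).  It follows from the fact that [w alpha_i] is
    nonnegative whenever [w s_i] is not shorter than [w] ([ascent_nonneg]):
    splitting off [w] a longest factor in the subgroup generated by two
    simple reflections reduces this, by induction on the length, to a
    calculation in that dihedral group. *)

Lemma exists_min_measure (T : Type) (f : T -> nat) (P : T -> Prop) :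
  (exists x, P x) -> exists2 x, P x & forall y, P y -> (f x <= f y)%N.
Proof.
case=> x0 Px0.
have ex : exists m, `[< exists2 x, P x & f x = m >].
  by exists (f x0); apply/asboolP; exists x0.
case: (ex_minnP ex) => m /asboolP[x Px <-] mmin.
by exists x => // y Py; apply: mmin; apply/asboolP; exists y.
Qed.

(** The reduced words of a dihedral group with generators [i] and [j] are
    among the [alt_word i j k] and the [alt_word j i k]. *)
Fixpoint alt_word (T : Type) (i j : T) (k : nat) : seq T :=
  if k is k'.+1 then i :: alt_word j i k' else [::].

Lemma size_alt_word (T : Type) (i j : T) k : size (alt_word i j k) = k.
Proof. by elim: k i j => //= k IH i j; rewrite IH. Qed.

Lemma take_alt_word (T : Type) (i j : T) m k :
  (m <= k)%N -> take m (alt_word i j k) = alt_word i j m.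
Proof. by elim: m k i j => [|m IH] [|k] i j //= mk; rewrite IH. Qed.

(** * Cones in a hyperplane *)

Section Cones.
Variables (R : realType) (n : nat).
Implicit Types (theta eta : 'rV[R]_n) (b f g x : 'cV[R]_n).
Implicit Types (F G : seq 'cV[R]_n).

Lemma pairingDl theta eta x :
  pairing (theta + eta) x = pairing theta x + pairing eta x.
Proof. by rewrite /pairing mulmxDl mxE. Qed.

Lemma pairingZl c theta x : pairing (c *: theta) x = c * pairing theta x.
Proof. by rewrite /pairing -scalemxAl mxE. Qed.

Lemma pairingDr theta x y :
  pairing theta (x + y) = pairing theta x + pairing theta y.
Proof. by rewrite /pairing mulmxDr mxE. Qed.

Lemma pairingZr c theta x : pairing theta (c *: x) = c * pairing theta x.
Proof. by rewrite /pairing -scalemxAr mxE. Qed.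

Lemma pairingNr theta x : pairing theta (- x) = - pairing theta x.
Proof. by rewrite -scaleN1r pairingZr mulN1r. Qed.

Lemma pairingE theta x : pairing theta x = \sum_k theta 0 k * x k 0.
Proof. by rewrite /pairing mxE. Qed.

Definition closed_cone b G : set 'rV[R]_n :=
  [set theta | perp b theta /\ forall f, f \in G -> 0 <= pairing theta f].

Definition open_cone b G : set 'rV[R]_n :=
  [set theta | perp b theta /\ forall f, f \in G -> 0 < pairing theta f].

Definition arrangement_complement b F : set 'rV[R]_n :=
  [set theta | perp b theta /\ forall f, f \in F -> pairing theta f != 0].

Definition signed (es : seq bool) F : seq 'cV[R]_n :=
  [seq (if p.1 then p.2 else - p.2) | p <- zip es F].

Lemma signed_sub es F g : size es = size F -> g \in signed es F ->
  g \in F \/ - g \in F.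
Proof.
elim: F es => [|f F IH] [|e es] //= [sz].
rewrite inE => /orP[/eqP ->|/(IH _ sz)[gF|gF]]; rewrite !inE ?gF ?orbT; auto.
by case: e; rewrite ?opprK eqxx; auto.
Qed.

Lemma mem_signed es F f : size es = size F -> f \in F ->
  f \in signed es F \/ - f \in signed es F.
Proof.
elim: F es => [|f' F IH] [|e es] //= [sz].
rewrite inE => /orP[/eqP ->|/(IH _ sz)[fF|fF]]; rewrite !inE ?fF ?orbT; auto.
by case: e; rewrite eqxx; auto.
Qed.

Lemma signed_signs_gt0 F theta : (forall f, f \in F -> pairing theta f != 0) ->
  forall g, g \in signed [seq 0 < pairing theta f | f <- F] F ->
  0 < pairing theta g.
Proof.
elim: F => [|f F IH] //= nz g; rewrite inE => /orP[/eqP ->|gF]; last first.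
  by apply: IH gF => h hF; apply: nz; rewrite inE hF orbT.
have := nz f (mem_head _ _); rewrite neq_lt => /orP[lt|lt]; rewrite /= ?lt //.
by rewrite (lt_gtF lt) pairingNr oppr_gt0.
Qed.

End Cones.

(** * Components of a hyperplane minus an arrangement *)

Section Arrangement.
Variables (R : realType) (n : nat).
Implicit Types (theta eta : 'rV[R]_n.+1) (b f g x : 'cV[R]_n.+1).
Implicit Types (F G : seq 'cV[R]_n.+1).

Lemma pairing_continuous x :
  continuous (fun theta : 'rV[R]_n.+1 => pairing theta x).
Proof.
move=> theta; have nbhsF := nbhs_filter theta.
rewrite (_ : (fun _ => _) = fun t : 'rV[R]_n.+1 => \sum_k t 0 k * x k 0).
  apply: cvg_big => [|k _]; first exact: add_continuous.
  by apply: cvgM; [exact: (@coord_continuous R 1 n.+1 0 k) | exact: cvg_cst].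
by apply/funext => t; rewrite pairingE.
Qed.

Lemma closed_cone_closed b G : closed (closed_cone b G).
Proof.
have -> : closed_cone b G = perp b `&`
    \bigcap_(f in [set` G]) [set theta | 0 <= pairing theta f].
  by apply/seteqP; split=> theta [].
apply: closedI.
  apply: (@preimage_closed _ _
    (fun theta : 'rV[R]_n.+1 => pairing theta b) [set 0]).
    by move=> theta _; exact: pairing_continuous.
  exact: closed_eq.
apply: closed_bigI => f _.
apply: (@preimage_closed _ _
  (fun theta : 'rV[R]_n.+1 => pairing theta f) [set t | 0 <= t]).
  by move=> theta _; exact: pairing_continuous.
exact: closed_ge.
Qed.

Lemma segment_continuous theta eta :
  continuous (fun t : R => theta + t *: eta).
Proof.
move=> t; apply: cvgD; first exact: cvg_cst.
by apply: cvgZr_tmp; exact: cvg_id.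
Qed.

(** A point [theta] of the closed cone is the limit of [theta + t *: eta] as
    [t] decreases to [0], for [eta] in the open cone. *)
Lemma closure_open_cone b G : open_cone b G !=set0 ->
  closure (open_cone b G) = closed_cone b G.
Proof.
case=> eta [eb eG]; apply/seteqP; split.
  rewrite [X in _ `<=` X](_ : _ = closure (closed_cone b G)).
    by apply: closureS => theta [tb tG]; split=> // f /tG /ltW.
  by apply/closure_id; exact: closed_cone_closed.
move=> theta [tb tG] B nB.
have : \forall t \near (0:R)^'+, B (theta + t *: eta).
  have := @segment_continuous theta eta 0.
  rewrite /continuous_at scale0r addr0 => c.
  exact: (cvg_at_right_filter c).
move=> nearB.
have [t [Bt t0]] : exists t : R, B (theta + t *: eta) /\ 0 < t.
  near (0:R)^'+ => t; exists t; split; near: t => //.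
  exact: nbhs_right_gt.
exists (theta + t *: eta); split=> //; split.
  by rewrite /perp /= pairingDl pairingZl tb eb mulr0 addr0.
move=> f fG; rewrite pairingDl pairingZl ltr_wpDl ?mulr_gt0 ?tG ?eG //.
Unshelve. all: by end_near.
Qed.

(** The image of a connected set under the form [x] is an interval, and this
    interval avoids [0]. *)
Lemma connected_same_sign x (C : set 'rV[R]_n.+1) theta eta : connected C ->
  C theta -> C eta -> (forall t, C t -> pairing t x != 0) ->
  0 < pairing theta x -> 0 < pairing eta x.
Proof.
move=> cC Ct Ce nz pt; rewrite ltNge; apply/negP => pe.
pose img := (fun t : 'rV[R]_n.+1 => pairing t x) @` C.
have /connected_intervalP interval : connected img.
  apply: connected_continuous_connected => //.
  by apply: continuous_subspaceT => t; exact: pairing_continuous.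
have he : img (pairing eta x) by exists eta.
have ht : img (pairing theta x) by exists theta.
have [|t Ct0 t0] := interval _ _ he ht 0; first by rewrite pe ltW.
by have := nz t Ct0; rewrite t0 eqxx.
Qed.

(** An open cone is convex, hence contained in one component; no form of [G]
    changes sign on a component, hence it contains that component. *)
Lemma component_open_cone b F G theta :
  (forall t, open_cone b G t -> arrangement_complement b F t) ->
  (forall g, g \in G -> g \in F \/ - g \in F) ->
  open_cone b G theta ->
  connected_component (arrangement_complement b F) theta = open_cone b G.
Proof.
move=> sub gF Ot; apply/seteqP; split=> eta.
  case=> C [Ct CX cC] Ceta; have [eb eF] := CX _ Ceta.
  split=> // g gG; apply: connected_same_sign cC Ct Ceta _ _.
    move=> t /CX[_ tF]; case: (gF g gG) => /tF //.
    by rewrite pairingNr oppr_eq0.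
  by case: Ot => _; apply.
move=> Oe; pose gamma (t : R) := theta + t *: (eta - theta).
have conn : connected (gamma @` `[0, 1]).
  apply: connected_continuous_connected; first exact: segment_connected.
  by apply: continuous_subspaceT => t; exact: segment_continuous.
apply: (connected_component_max _ _ conn).
- by exists 0; rewrite /= ?in_itv /= ?lexx ?ler01 // /gamma scale0r addr0.
- move=> z [t]; rewrite /= in_itv /= => /andP[t0 t1] <-{z}; apply: sub.
  have lin x : pairing (gamma t) x =
      (1 - t) * pairing theta x + t * pairing eta x.
    rewrite pairingDl pairingZl pairingDl -scaleN1r pairingZl; ring.
  case: Ot Oe => tb tG [eb eG]; split.
    by rewrite /perp /= lin tb eb !mulr0 addr0.
  move=> f fG; rewrite lin; have := tG f fG; have := eG f fG => pe pt.
  have [->|t_neq0] := eqVneq t 0; first by rewrite subr0 mul1r mul0r addr0.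
  rewrite ltr_wpDl //; first by rewrite mulr_ge0 ?subr_ge0 // ltW.
  by rewrite mulr_gt0 // lt_neqAle eq_sym t_neq0.
- by exists 1; rewrite /= ?in_itv /= ?lexx ?ler01 // /gamma scale1r addrC subrK.
Qed.

Lemma perp_vspace b : b != 0 ->
  exists2 H : {vspace 'rV[R]_n.+1},
    (forall theta, (theta \in H) = (pairing theta b == 0)) & \dim H = n.
Proof.
move=> b0; pose L := linfun (mulmxr b : 'rV[R]_n.+1 -> 'M[R]_1).
have LE theta : (L theta == 0) = (pairing theta b == 0).
  rewrite lfunE /= /pairing; apply/eqP/eqP => [->|e]; first by rewrite mxE.
  by apply/matrixP => i j; rewrite !ord1 e mxE.
exists (lker L) => [theta|]; first by rewrite memv_ker LE.
have dimL : \dim (limg L) = 1%N.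
  apply/eqP; rewrite eqn_leq; apply/andP; split.
    by rewrite (leq_trans (dimvS (subvf _))) // dimvf /dim /=.
  rewrite lt0n dimv_eq0; apply: contra b0 => /eqP L0.
  apply/eqP/colP => k; rewrite mxE.
  have : L (delta_mx 0 k) == 0 by rewrite -memv0 -L0 memv_img ?memvf.
  by rewrite LE /pairing -rowE mxE => /eqP.
have := limg_ker_dim L fullv; rewrite dimL capfv dimvf /dim /= mul1n.
by rewrite addn1 => -[].
Qed.

Lemma perp_sub_perp b f : b != 0 ->
  (forall theta, perp b theta -> perp f theta) -> exists c, f = c *: b.
Proof.
move=> b0 bf; have [i bi] : exists i, b i 0 != 0.
  apply: contrapT => none; move/eqP: b0; apply; apply/colP => k; rewrite mxE.
  by apply/eqP/negPn/negP => bk; apply: none; exists k.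
exists (f i 0 / b i 0); apply/colP => k; rewrite mxE.
have e l x : pairing (delta_mx 0 l : 'rV[R]_n.+1) x = x l 0.
  by rewrite /pairing -rowE mxE.
have := bf (b k 0 *: delta_mx 0 i - b i 0 *: delta_mx 0 k).
rewrite /perp /= -scaleNr !pairingDl !pairingZl !e mulrC mulNr subrr.
move=> /(_ erefl)/eqP; rewrite mulNr subr_eq0 => /eqP h.
by rewrite mulrAC [f i 0 * _]mulrC h mulrC mulKf.
Qed.

(** If each form of [G] is positive somewhere on the closed cone, the sum of
    such points is positive on all of [G]. *)
Lemma open_cone_empty_flat b G : open_cone b G = set0 ->
  exists2 f, f \in G & forall theta, closed_cone b G theta -> perp f theta.
Proof.
move=> O0; apply: contrapT => none.
have pos f : f \in G ->
    exists2 theta, closed_cone b G theta & 0 < pairing theta f.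
  move=> fG; apply: contrapT => nf; apply: none; exists f => // theta ct.
  apply/eqP; rewrite eq_le andbC; case: (ct) => _ /(_ f fG) -> /=.
  by rewrite leNgt; apply/negP => lt; apply: nf; exists theta.
have [theta [tb tG] tpos] : exists2 theta, closed_cone b G theta &
    forall f, f \in G -> 0 < pairing theta f.
  have : {subset G <= G} by [].
  elim: {1 4}G => [_|f F IH sub].
    exists 0 => //; split; first by rewrite /perp /= /pairing mul0mx mxE.
    by move=> f _; rewrite /pairing mul0mx mxE.
  have [|theta ct tF] := IH.
    by move=> g gF; apply: sub; rewrite inE gF orbT.
  have [|eta ce ef] := pos f; first by apply: sub; rewrite mem_head.
  case: (ct) (ce) => tb tG [eb eG]; exists (theta + eta).
    split; first by rewrite /perp /= pairingDl tb eb addr0.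
    by move=> g gG; rewrite pairingDl addr_ge0 ?tG ?eG.
  move=> g; rewrite inE pairingDl => /orP[/eqP ->|gF].
    by rewrite ltr_wpDl // tG // sub ?mem_head.
  by rewrite ltr_pwDl ?tF // eG // sub // inE gF orbT.
have : open_cone b G theta by split.
by rewrite O0.
Qed.

Lemma small_step G theta eta : (forall f, f \in G -> 0 < pairing theta f) ->
  exists2 t : R, 0 < t & forall f, f \in G -> 0 <= pairing (theta + t *: eta) f.
Proof.
elim: G => [_|g G IH pos]; first by exists 1.
have [|t t0 tG] := IH; first by move=> f fG; apply: pos; rewrite inE fG orbT.
have pg : 0 < pairing theta g by apply: pos; rewrite mem_head.
(* This [u] satisfies [u * |pairing eta g| <= pairing theta g]. *)
pose u := pairing theta g / (1 + `|pairing eta g|).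
have u0 : 0 < u by rewrite divr_gt0 // ltr_wpDr.
have bound f v w : 0 < pairing theta f -> 0 < v <= w ->
    0 <= pairing (theta + w *: eta) f -> 0 <= pairing (theta + v *: eta) f.
  rewrite !pairingDl !pairingZl => pf /andP[v0 vw] pw.
  have [pe|pe] := leP 0 (pairing eta f).
    by rewrite addr_ge0 ?mulr_ge0 // ltW.
  apply: le_trans pw _; rewrite lerD2l.
  by rewrite ler_wnM2r // ltW.
have m0 : 0 < Num.min t u by rewrite lt_min t0.
exists (Num.min t u) => // f; rewrite inE => /orP[/eqP ->|fG]; last first.
  apply: bound (tG f fG); first by apply: pos; rewrite inE fG orbT.
  by rewrite m0 ge_min lexx.
apply: (bound _ _ u) => //; first by rewrite m0 ge_min lexx orbT.
rewrite pairingDl pairingZl /u -mulrA.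
have := ler_norm (- pairing eta g); rewrite normrN => le.
rewrite -[X in X + _]mulr1 -mulrDr mulr_ge0 ?(ltW pg) //.
have q0 : 0 < 1 + `|pairing eta g| by rewrite ltr_wpDr.
rewrite -(pmulr_lge0 _ q0) mulrDl mul1r mulrAC mulVf ?gt_eqF // mul1r.
by lra.
Qed.

Lemma open_cone_sub_complement b F es : size es = size F ->
  open_cone b (signed es F) `<=` arrangement_complement b F.
Proof.
move=> sz theta [tb tG]; split=> // f /(mem_signed sz)[] /tG.
  by move/gt_eqF/negbT.
by rewrite pairingNr oppr_gt0 => /lt_eqF/negbT.
Qed.

(** The cone has interior points relative to its hyperplane: a small multiple
    of any [eta] in [perp b], added to a point of the open cone, stays in the
    closed cone. *)
Lemma span_dim_of_open_cone b G : b != 0 -> open_cone b G !=set0 ->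
  span_dim (closed_cone b G) n.
Proof.
move=> b0 [theta [tb tG]]; have [H memH dimH] := perp_vspace b0.
exists H => //; split=> [eta [/eqP]|V subV]; first by rewrite memH.
apply/subvP => eta; rewrite memH => /eqP eb.
have [t t0 te] := small_step eta tG.
rewrite -[eta](scalerK (lt0r_neq0 t0)) memvZ //.
rewrite -[t *: eta](addKr theta) addrC rpredB //; apply: subV; split=> //.
  by rewrite /perp /= pairingDl pairingZl tb eb mulr0 addr0.
by move=> f /tG /ltW.
Qed.

(** Otherwise the cone lies in the kernel of some [g] in [G] as well as in
    [perp b], two different hyperplanes. *)
Lemma open_cone_of_span_dim b G : b != 0 ->
  (forall g c, g \in G -> g <> c *: b) ->
  span_dim (closed_cone b G) n -> open_cone b G !=set0.
Proof.
move=> b0 nG [V [subV minV] dimV]; apply/set0P/eqP => O0.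
have [f fG flat] := open_cone_empty_flat O0.
have [H memH dimH] := perp_vspace b0.
have VH : V = H.
  apply/eqP; rewrite eqEdim dimV dimH leqnn andbT.
  by apply: minV => theta [/eqP]; rewrite memH.
have f0 : f != 0 by apply/eqP => f0; apply: (nG f 0 fG); rewrite f0 scale0r.
have [Hf memHf _] := perp_vspace f0.
have VHf : (V <= Hf)%VS by apply: minV => theta /flat /eqP; rewrite memHf.
have [|c fc] := @perp_sub_perp b f b0; last exact: nG fc.
move=> theta /eqP; rewrite -memH -VH => /(subvP VHf).
by rewrite memHf => /eqP.
Qed.

Theorem arrangement_component_closures b F : b != 0 ->
  (forall f c, f \in F -> f <> c *: b) ->
  [set closure (connected_component (arrangement_complement b F) theta)
    | theta in arrangement_complement b F] =
  [set K | span_dim K n /\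
     exists2 es, size es = size F & K = closed_cone b (signed es F)].
Proof.
move=> b0 nF; have component es theta : size es = size F ->
    open_cone b (signed es F) theta ->
    closure (connected_component (arrangement_complement b F) theta) =
    closed_cone b (signed es F).
  move=> sz Ot; rewrite (@component_open_cone b F (signed es F)) //.
  - by rewrite closure_open_cone //; exists theta.
  - exact: open_cone_sub_complement.
  - by move=> g; exact: signed_sub.
apply/seteqP; split=> [_ [theta [tb tF] <-]|K [spanK [es sz eK]]].
  set es := [seq 0 < pairing theta f | f <- F].
  have sz : size es = size F by rewrite size_map.
  have Ot : open_cone b (signed es F) theta.
    by split=> //; exact: signed_signs_gt0.
  rewrite (component es theta sz Ot); split; last by exists es.
  by apply: span_dim_of_open_cone => //; exists theta.
rewrite eK in spanK *.
have [|theta Ot] := open_cone_of_span_dim b0 _ spanK.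
  move=> g c /(signed_sub sz)[gF|gF] e; first exact: nF gF e.
  by apply: (nF _ (- c) gF); rewrite scaleNr -e.
exists theta; first exact: open_cone_sub_complement Ot.
exact: component.
Qed.

End Arrangement.

(** * Simple reflections *)

Section RootSystem.
Variables (R : realType) (n : nat) (d : 'I_n -> nat) (A : 'M[int]_n).
Hypothesis hA : sym_cartan d A.

Local Notation s i := (refl R d A i).
Local Notation al i := (simple_root R i).
Local Notation app := (apply_refls d A).
Local Notation Phi := (Defs.roots d A).
Local Notation coroot i x := (bform d A (simple_coroot R d i) x).

Lemma bformDr (x y z : 'cV[R]_n) :
  bform d A x (y + z) = bform d A x y + bform d A x z.
Proof. by rewrite /bform mulmxDr mxE. Qed.

Lemma bformZr (x y : 'cV[R]_n) c : bform d A x (c *: y) = c * bform d A x y.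
Proof. by rewrite /bform -scalemxAr mxE. Qed.

Lemma bformC (x y : 'cV[R]_n) : bform d A x y = bform d A y x.
Proof.
have symG : (gram R d A)^T = gram R d A.
  apply/matrixP => i j; rewrite !mxE; case: hA => _ _ sym _.
  have := congr1 (fun z : int => z%:~R : R) (sym i j).
  by rewrite !rmorphM /= => ->.
rewrite /bform -[LHS](mxE trmx_key (fun i j => ((x^T *m gram R d A *m y) j i))).
by rewrite -/(trmx _) !trmx_mul trmxK symG mulmxA.
Qed.

Lemma bformDl (x y z : 'cV[R]_n) :
  bform d A (y + z) x = bform d A y x + bform d A z x.
Proof. by rewrite bformC bformDr !(bformC x). Qed.

Lemma bformZl (x y : 'cV[R]_n) c : bform d A (c *: y) x = c * bform d A y x.
Proof. by rewrite bformC bformZr (bformC x). Qed.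

Lemma d_neq0 i : (d i)%:R != 0 :> R.
Proof. by case: hA => d_gt0 _ _ _; rewrite pnatr_eq0 -lt0n. Qed.

Lemma coroot_simple i k : coroot i (al k) = (A i k)%:~R.
Proof. by rewrite bformZl bform_simple mulrA mulVf ?mul1r ?d_neq0. Qed.

Lemma coroot_simple_self i : coroot i (al i) = 2.
Proof. by rewrite coroot_simple; case: hA => _ -> _ _. Qed.

Lemma refl_simple i : s i *m al i = - al i.
Proof.
by rewrite reflE coroot_simple_self scaler_nat mulr2n opprD addrA subrr add0r.
Qed.

Lemma reflK i (x : 'cV[R]_n) : s i *m (s i *m x) = x.
Proof.
rewrite [s i *m x]reflE mulmxBr -scalemxAr refl_simple reflE.
by rewrite scalerN opprK subrK.
Qed.

Lemma refl_mul_refl i : s i *m s i = 1%:M.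
Proof.
apply/matrixP => k l; have := reflK i (delta_mx l 0).
by rewrite mulmxA -colE => /colP/(_ k); rewrite !mxE eqxx andbT => ->.
Qed.

Lemma invmx_refl i : invmx (s i) = s i.
Proof.
have u := refl_unit R i hA.
by rewrite -[RHS]mul1mx -(mulVmx u) -mulmxA refl_mul_refl mulmx1.
Qed.

Lemma refl_other_coord i k (x : 'cV[R]_n) : k != i -> (s i *m x) k 0 = x k 0.
Proof. by move=> ki; rewrite reflE !mxE (negbTE ki) mulr0 subr0. Qed.

Lemma bform_refl i (x y : 'cV[R]_n) :
  bform d A (s i *m x) (s i *m y) = bform d A x y.
Proof.
have e z : bform d A (al i) z = (d i)%:R * coroot i z.
  by rewrite bformZl mulrA mulfV ?mul1r ?d_neq0.
have eN z c : - (c *: z) = (- c) *: z :> 'cV[R]_n by rewrite scaleNr.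
rewrite !reflE !eN !bformDl !bformDr !bformZl !bformZr (bformC x (al i)) !e.
by rewrite coroot_simple_self !(mulKf (d_neq0 i)); ring.
Qed.

(** * Words in the simple reflections *)

Lemma app_cat u v (x : 'cV[R]_n) : app (u ++ v) x = app v (app u x).
Proof. by rewrite /apply_refls foldl_cat. Qed.

Lemma app_rcons u i (x : 'cV[R]_n) : app (rcons u i) x = s i *m app u x.
Proof. by rewrite -cats1 app_cat. Qed.

Lemma appD u (x y : 'cV[R]_n) : app u (x + y) = app u x + app u y.
Proof. by elim: u x y => //= i u IH x y; rewrite mulmxDr IH. Qed.

Lemma appZ u c (x : 'cV[R]_n) : app u (c *: x) = c *: app u x.
Proof. by elim: u x => //= i u IH x; rewrite -scalemxAr IH. Qed.

Lemma appN u (x : 'cV[R]_n) : app u (- x) = - app u x.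
Proof. by rewrite -scaleN1r appZ scaleN1r. Qed.

Lemma app_revK u (x : 'cV[R]_n) : app (rev u) (app u x) = x.
Proof.
elim: u x => //= i u IH x.
by rewrite rev_cons app_rcons IH reflK.
Qed.

Lemma app_bform u (x y : 'cV[R]_n) :
  bform d A (app u x) (app u y) = bform d A x y.
Proof. by elim: u x y => //= i u IH x y; rewrite IH bform_refl. Qed.

Lemma weyl_word w : weyl d A w ->
  exists u, forall x : 'cV[R]_n, w *m x = app u x.
Proof.
suff main w' : weyl d A w' ->
    w' \in unitmx /\ exists u, forall x : 'cV[R]_n, w' *m x = app u x.
  by case/main.
elim=> [|i|w1 w2 _ [u1 [l1 e1]] _ [u2 [l2 e2]]|v _ [uv [l e]]].
- by split; [exact: unitmx1 | exists [::] => x; rewrite mul1mx].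
- by split; [exact: refl_unit | exists [:: i]].
- split; first by rewrite unitmx_mul u1.
  by exists (l2 ++ l1) => x; rewrite app_cat -mulmxA e2 e1.
- split; first by rewrite unitmx_inv.
  exists (rev l) => x.
  by rewrite -{2}[x](mulKVmx uv) e app_revK.
Qed.

Lemma word_weyl u :
  exists2 w, weyl d A w & forall x : 'cV[R]_n, app u x = w *m x.
Proof.
elim/last_ind: u => [|u i [w ww e]].
  by exists 1%:M => [|x]; [exact: weyl_one | rewrite mul1mx].
exists (s i *m w) => [|x]; last by rewrite app_rcons e mulmxA.
by apply: weyl_mul => //; exact: weyl_refl.
Qed.

Lemma rootsP (x : 'cV[R]_n) : Phi x <-> exists u i, x = app u (al i).
Proof.
split=> [[w [i [/weyl_word[u e] ->]]]|[u [i ->]]]; first by exists u, i.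
by have [w ww ->] := word_weyl u; exists w, i.
Qed.

Lemma app_root u (x : 'cV[R]_n) : Phi x -> Phi (app u x).
Proof.
by case/rootsP => v [i ->]; apply/rootsP; exists (v ++ u), i; rewrite app_cat.
Qed.

Lemma refl_root i (x : 'cV[R]_n) : Phi x -> Phi (s i *m x).
Proof. by move/(app_root [:: i]). Qed.

Lemma simple_is_root (i : 'I_n) : Phi (al i).
Proof. by apply/rootsP; exists [::], i. Qed.

Lemma opp_root (x : 'cV[R]_n) : Phi x -> Phi (- x).
Proof.
case/rootsP => u [i ->]; apply/rootsP; exists (i :: u), i.
by rewrite /= refl_simple appN.
Qed.

Lemma simple_root_neq0 (i : 'I_n) : al i != 0.
Proof.
apply/eqP => /colP/(_ i); rewrite !mxE !eqxx => /eqP; by rewrite oner_eq0.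
Qed.

Lemma root_neq0 (x : 'cV[R]_n) : Phi x -> x != 0.
Proof.
case/rootsP => u [i ->]; apply/eqP => e.
have := app_revK u (al i); rewrite e -(scale0r (al i)) appZ scale0r.
by move/esym/eqP; rewrite (negbTE (simple_root_neq0 i)).
Qed.

(** * Dihedral groups generated by two simple reflections *)

Section Dihedral.
Variables (i j : 'I_n) (a b : R).
Hypotheses (Aij : (A i j)%:~R = - a) (Aji : (A j i)%:~R = - b).

(** Words in [i] and [j] move [x] only along [al i] and [al j], so their action
    on all of the space is a calculation with two coefficients. *)
Lemma refl_left (x : 'cV[R]_n) p q :
  s i *m (x + p *: al i + q *: al j) =
    x + (a * q - p - coroot i x) *: al i + q *: al j.
Proof.
rewrite reflE !bformDr !bformZr coroot_simple_self coroot_simple Aij.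
rewrite -!addrA; congr (_ + _); rewrite addrCA [RHS]addrC; congr (_ + _).
by rewrite -scalerBl; congr (_ *: _); ring.
Qed.

Lemma refl_right (x : 'cV[R]_n) p q :
  s j *m (x + p *: al i + q *: al j) =
    x + p *: al i + (b * p - q - coroot j x) *: al j.
Proof.
rewrite reflE !bformDr !bformZr coroot_simple_self coroot_simple Aji.
rewrite -!addrA; congr (_ + (_ + _)).
by rewrite -scalerBl; congr (_ *: _); ring.
Qed.

Definition in_cone (x y z : 'cV[R]_n) : Prop :=
  exists p q : R, [/\ 0 <= p, 0 <= q & z = p *: x + q *: y].

Lemma app_cons_left u (x : 'cV[R]_n) p q :
  app (i :: u) (x + p *: al i + q *: al j) =
  app u (x + (a * q - p - coroot i x) *: al i + q *: al j).
Proof. by rewrite -refl_left. Qed.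

Lemma app_cons_right u (x : 'cV[R]_n) p q :
  app (j :: u) (x + p *: al i + q *: al j) =
  app u (x + p *: al i + (b * p - q - coroot j x) *: al j).
Proof. by rewrite -refl_right. Qed.

(** What positivity needs to know about the order [m] of [s i *m s j].  Both
    clauses are void for [m = 0], whence the condition [0 < m] in
    [dihedral_cases]. *)
Definition dihedral_order (m : nat) : Prop :=
  (forall x : 'cV[R]_n,
     app (alt_word i j m) x = app (alt_word j i m) x) /\
  forall k, (k < m)%N -> in_cone (al i) (al j) (app (alt_word j i k) (al i)).

Lemma bform0r (x : 'cV[R]_n) : bform d A x 0 = 0.
Proof. by rewrite -(scale0r 0) bformZr mul0r. Qed.

Lemma dihedral_order_intro m :
  (forall (x : 'cV[R]_n) p q,
     app (alt_word i j m) (x + p *: al i + q *: al j) =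
     app (alt_word j i m) (x + p *: al i + q *: al j)) ->
  (forall k, (k < m)%N -> exists p q : R, [/\ 0 <= p, 0 <= q &
     app (alt_word j i k) (0 + 1 *: al i + 0 *: al j) =
     0 + p *: al i + q *: al j]) ->
  dihedral_order m.
Proof.
move=> braid cone; split=> [x|k km].
  by have := braid x 0 0; rewrite !scale0r !addr0.
have [p [q [p0 q0 e]]] := cone k km; exists p, q; split=> //.
by move: e; rewrite !add0r scale1r scale0r addr0.
Qed.

Ltac solve_braid a0 b0 :=
  move=> x p q; rewrite /alt_word !(app_cons_left, app_cons_right) /= a0 b0;
  congr (_ + _ *: _ + _ *: _); ring.

Ltac solve_cone a0 b0 :=
  rewrite /alt_word ?(app_cons_left, app_cons_right) /= ?bform0r ?a0 ?b0;
  do 2!eexists; split; try reflexivity; lra.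

(** As [a] and [b] vanish together, these are all the values with
    [a * b < 4], which give the finite dihedral groups. *)
Lemma dihedral_order_2 : a = 0 -> b = 0 -> dihedral_order 2.
Proof.
move=> a0 b0; apply: dihedral_order_intro; first by solve_braid a0 b0.
by case=> [_|[_|//]]; solve_cone a0 b0.
Qed.

Lemma dihedral_order_3 : a = 1 -> b = 1 -> dihedral_order 3.
Proof.
move=> a0 b0; apply: dihedral_order_intro; first by solve_braid a0 b0.
by case=> [_|[_|[_|//]]]; solve_cone a0 b0.
Qed.

Lemma dihedral_order_4l : a = 1 -> b = 2 -> dihedral_order 4.
Proof.
move=> a0 b0; apply: dihedral_order_intro; first by solve_braid a0 b0.
by case=> [_|[_|[_|[_|//]]]]; solve_cone a0 b0.
Qed.

Lemma dihedral_order_4r : a = 2 -> b = 1 -> dihedral_order 4.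
Proof.
move=> a0 b0; apply: dihedral_order_intro; first by solve_braid a0 b0.
by case=> [_|[_|[_|[_|//]]]]; solve_cone a0 b0.
Qed.

Lemma dihedral_order_6l : a = 1 -> b = 3 -> dihedral_order 6.
Proof.
move=> a0 b0; apply: dihedral_order_intro; first by solve_braid a0 b0.
by case=> [_|[_|[_|[_|[_|[_|//]]]]]]; solve_cone a0 b0.
Qed.

Lemma dihedral_order_6r : a = 3 -> b = 1 -> dihedral_order 6.
Proof.
move=> a0 b0; apply: dihedral_order_intro; first by solve_braid a0 b0.
by case=> [_|[_|[_|[_|[_|[_|//]]]]]]; solve_cone a0 b0.
Qed.

End Dihedral.

(** When [4 <= a * b], the inequality [2 * q <= b * p] reproduces itself with
    the roles of [i] and [j] exchanged, so coefficients never become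
    negative. *)
Lemma infinite_dihedral_cone k : forall (i j : 'I_n) (a b p q : R), i != j ->
    (A i j)%:~R = - a -> (A j i)%:~R = - b -> 0 <= a -> 0 <= b -> 4 <= a * b ->
    0 <= p -> 0 <= q -> 2 * q <= b * p ->
  in_cone (al i) (al j) (app (alt_word j i k) (p *: al i + q *: al j)).
Proof.
elim: k => [|k IH] i j a b p q ij Aij Aji a0 b0 ab p0 q0 qp.
  by exists p, q.
have e : s j *m (p *: al i + q *: al j) = (b * p - q) *: al j + p *: al i.
  have := refl_right Aji 0 p q.
  by rewrite bform0r subr0 !add0r => ->; rewrite addrC.
have ji : j != i by rewrite eq_sym.
have ba : 4 <= b * a by rewrite mulrC.
have pq0 : 0 <= b * p - q by lra.
have pq : 2 * p <= a * (b * p - q).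
  have : a * (2 * q) <= a * (b * p) by apply: ler_wpM2l.
  have : 4 * p <= (a * b) * p by apply: ler_wpM2r.
  by lra.
have [p' [q' [? ?]]] := IH j i b a _ p ji Aji Aij b0 a0 ba pq0 p0 pq.
rewrite /= e => ->.
by exists q', p'; split=> //; rewrite addrC.
Qed.

Lemma cartan_offdiag i j : i != j ->
  exists a b : nat,
    [/\ A i j = - a%:Z, A j i = - b%:Z & (a == 0%N) = (b == 0%N)].
Proof.
move=> ij; case: hA => d0 _ sym neg.
have n1 := neg _ _ ij; have n2 : A j i <= 0 by apply: neg; rewrite eq_sym.
exists `|A i j|%N, `|A j i|%N; split; try lia.
have := sym i j; have := d0 i; have := d0 j; rewrite !absz_eq0.
case: (eqVneq (A i j) 0) => [->|nz] dj di; rewrite ?mulr0.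
  by move/esym/eqP; rewrite mulf_eq0 eqz_nat gtn_eqF //= => ->.
case: (eqVneq (A j i) 0) => [->|//]; rewrite mulr0 => /eqP.
by rewrite mulf_eq0 (negbTE nz) orbF eqz_nat gtn_eqF.
Qed.

Lemma dihedral_cases (i j : 'I_n) : i != j ->
  (forall k, in_cone (al i) (al j) (app (alt_word j i k) (al i))) \/
  exists2 m, (0 < m)%N & dihedral_order i j m.
Proof.
move=> ij; have [a [b [ea eb zab]]] := cartan_offdiag ij.
have Aij : (A i j)%:~R = - a%:R :> R by rewrite ea rmorphN.
have Aji : (A j i)%:~R = - b%:R :> R by rewrite eb rmorphN.
have [ab|ab] := leqP 4 (a * b).
  left=> k; have := @infinite_dihedral_cone k i j a%:R b%:R 1 0 ij Aij Aji.
  rewrite scale1r scale0r addr0; apply; rewrite ?ler0n ?ler01 ?lexx //.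
    by rewrite -natrM ler_nat.
  by rewrite mulr0 mulr1 ler0n.
right; move: a b ab zab Aij Aji {ea eb}.
have small a b : (a * b < 4)%N -> (a == 0%N) = (b == 0%N) ->
   (a, b) \in [:: (0, 0); (1, 1); (1, 2); (2, 1); (1, 3); (3, 1)]%N.
  case: a b => [|a] [|b] //= ab _.
  have aa : (a < 4)%N by apply: leq_ltn_trans ab; rewrite mulSn mulnS; lia.
  have bb : (b < 4)%N by apply: leq_ltn_trans ab; rewrite mulSn mulnS; lia.
  by move: a b aa bb ab => [|[|[|[|a]]]] [|[|[|[|b]]]].
move=> a b ab zab Aij Aji; have := small a b ab zab.
rewrite !inE !xpair_eqE.
case/orP=> [/andP[/eqP ea /eqP eb]|].
  by exists 2%N; [|apply: (dihedral_order_2 Aij Aji); rewrite ?ea ?eb].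
case/orP=> [/andP[/eqP ea /eqP eb]|].
  by exists 3%N; [|apply: (dihedral_order_3 Aij Aji); rewrite ?ea ?eb].
case/orP=> [/andP[/eqP ea /eqP eb]|].
  by exists 4%N; [|apply: (dihedral_order_4l Aij Aji); rewrite ?ea ?eb].
case/orP=> [/andP[/eqP ea /eqP eb]|].
  by exists 4%N; [|apply: (dihedral_order_4r Aij Aji); rewrite ?ea ?eb].
case/orP=> [/andP[/eqP ea /eqP eb]|/andP[/eqP ea /eqP eb]].
  by exists 6%N; [|apply: (dihedral_order_6l Aij Aji); rewrite ?ea ?eb].
by exists 6%N; [|apply: (dihedral_order_6r Aij Aji); rewrite ?ea ?eb].
Qed.

Definition same_action (u v : seq 'I_n) : Prop :=
  forall x : 'cV[R]_n, app u x = app v x.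

(** With [l = size u] this says that [u] is reduced. *)
Definition no_shorter (l : nat) (u : seq 'I_n) : Prop :=
  forall v, same_action v u -> (l <= size v)%N.

(** For [k] at least the order [m], the braid relation rewrites the first [m]
    letters to start with [i], which makes [i :: alt_word j i k] equal to a
    word of length [k - 1]. *)
Lemma dihedral_positive (i j : 'I_n) k : i != j ->
  no_shorter k (i :: alt_word j i k) ->
  in_cone (al i) (al j) (app (alt_word j i k) (al i)).
Proof.
move=> ij min; case: (dihedral_cases ij) => [//|[m m0 [braid cone]]].
have [/cone //|mk] := ltnP k m.
set t := drop m (alt_word j i k).
have e : alt_word j i k = alt_word j i m ++ t.
  by rewrite -(take_alt_word j i mk) cat_take_drop.
have sz : size t = (k - m)%N by rewrite size_drop size_alt_word.
have := min (alt_word j i m.-1 ++ t).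
rewrite size_cat size_alt_word sz.
suff h : same_action (alt_word j i m.-1 ++ t) (i :: alt_word j i k).
  by move/(_ h); lia.
move=> x; rewrite e /= app_cat [in RHS]app_cat -braid.
by case: (m) m0 => //= m' _; rewrite reflK.
Qed.

(** * Roots are positive or negative *)

Lemma reduced_alternates (i j : 'I_n) v : all (mem [:: i; j]) v ->
  no_shorter (size v) v -> no_shorter (size v) (i :: v) ->
  v = alt_word j i (size v).
Proof.
elim: v i j => //= c v IH i j /andP[cij vij] red red_i.
have cj : c = j.
  move: cij; rewrite !inE => /orP[/eqP ci|/eqP//].
  have := red_i v; rewrite ltnn; case/(_ _)/notF => x.
  by rewrite /= ci reflK.
rewrite cj in red red_i *; congr (_ :: _); apply: IH.
- by apply: sub_all vij => k; rewrite /= !inE orbC.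
- by move=> u uv; have := red (j :: u); rewrite ltnS; apply=> x; rewrite /= uv.
- by move=> u uv; apply: ltnW; apply: red.
Qed.

Lemma app_nonneg_in_cone u (x y z : 'cV[R]_n) :
  (forall k, 0 <= app u x k 0) -> (forall k, 0 <= app u y k 0) ->
  in_cone x y z -> forall k, 0 <= app u z k 0.
Proof.
move=> x0 y0 [p [q [p0 q0 ->]]] k.
by rewrite appD !appZ !mxE; apply: addr_ge0; apply: mulr_ge0.
Qed.

Lemma simple_ge0 (i k : 'I_n) : 0 <= al i k 0.
Proof. by rewrite mxE ler0n. Qed.

(** Among the factorizations of [l] as [v ++ u] with [v] a word in the letters
    [i] and [j], where [j] is the first letter of [l], one with [u] shortest is
    taken.  Prefixing [i] or [j] to [u] cannot shorten it, for the letter could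
    be moved to [v]; by induction [u] maps [al i] and [al j] to nonnegative
    vectors.  By the dihedral case, [v] maps [al i] to a nonnegative combination
    of [al i] and [al j]. *)
Lemma ascent_nonneg l (i : 'I_n) :
  no_shorter (size l) l -> no_shorter (size l) (i :: l) ->
  forall k, 0 <= app l (al i) k 0.
Proof.
have [N] := ubnP (size l); elim: N l i => // N IH [|j l0] i sizel red asc.
  exact: simple_ge0.
set l := j :: l0 in sizel red asc *.
have ij : i != j.
  apply/eqP => ij; have := asc l0; rewrite /= ltnn; case/(_ _)/notF => x.
  by rewrite /= ij reflK.
pose splits u := exists v, [/\ all (mem [:: i; j]) v,
  same_action (v ++ u) l & size (v ++ u) = size l].
have [|u [v [vij vul sz]] umin] := @exists_min_measure _ size splits.
  by exists l0, [:: j]; rewrite /= !inE eqxx orbT.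
have ul0 : (size u <= size l0)%N.
  by apply: umin; exists [:: j]; rewrite /= !inE eqxx orbT.
rewrite size_cat in sz.
have redu : no_shorter (size u) u.
  move=> u' uu'; rewrite -(leq_add2l (size v)) sz -size_cat; apply: red => x.
  by rewrite -vul !app_cat uu'.
have ascu c : c \in [:: i; j] -> no_shorter (size u) (c :: u).
  move=> cij u' uu'; rewrite leqNgt; apply/negP => lt_u'u.
  have eu' : same_action (rcons v c ++ u') l.
    by move=> x; rewrite -vul !app_cat app_rcons uu' /= reflK.
  have := red _ eu'; rewrite size_cat size_rcons => le_l.
  have : (size u <= size u')%N.
    apply: umin; exists (rcons v c); split=> //.
      by rewrite all_rcons vij andbT.
    rewrite size_cat size_rcons; apply/eqP.
    by rewrite eqn_leq le_l andbT -sz addSnnS leq_add2l.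
  by rewrite leqNgt lt_u'u.
have posu c : c \in [:: i; j] -> forall k, 0 <= app u (al c) k 0.
  by move=> cij; apply: IH (ascu c cij) => //; apply: leq_ltn_trans ul0 _.
have redv : no_shorter (size v) v.
  move=> v' vv'; rewrite -(leq_add2r (size u)) sz -size_cat; apply: red => x.
  by rewrite -vul !app_cat vv'.
have ascv : no_shorter (size v) (i :: v).
  move=> v' vv'; rewrite -(leq_add2r (size u)) sz -size_cat; apply: asc => x.
  by rewrite app_cat vv' /= -app_cat; exact: vul.
have ev := reduced_alternates vij redv ascv.
have cone : in_cone (al i) (al j) (app v (al i)).
  by rewrite ev; apply: dihedral_positive; rewrite -?ev.
move=> k; rewrite -/l -vul app_cat.
by apply: app_nonneg_in_cone cone _; apply: posu; rewrite !inE eqxx ?orbT.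
Qed.

(** Of a group element [w] and [w s_i], the shorter one maps [al i] to a
    nonnegative vector, and the two images are opposite. *)
Lemma root_sign (x : 'cV[R]_n) :
  Phi x -> (forall k, 0 <= x k 0) \/ (forall k, x k 0 <= 0).
Proof.
case/rootsP => u [i ->{x}].
have shortest w : exists2 l, same_action l w & no_shorter (size l) w.
  have [|l lw lmin] :=
      @exists_min_measure _ size (fun l => same_action l w).
    by exists w.
  by exists l.
have trans a b c : same_action a b -> no_shorter c b -> no_shorter c a.
  by move=> ab cb v va; apply: cb => x; rewrite va.
have [l lu lmin] := shortest u.
have [l' lu' lmin'] := shortest (i :: u).
have [le|lt] := leqP (size l) (size l').
  left; rewrite -lu; apply: ascent_nonneg; first exact: trans lmin.
  by move=> v vl; apply: leq_trans le (lmin' _ _) => x; rewrite vl /= lu.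
right=> k; rewrite -[al i]opprK -refl_simple appN mxE oppr_le0.
have -> : app u (s i *m al i) = app l' (al i) by rewrite lu'.
apply: ascent_nonneg; first exact: trans lmin'.
move=> v vl; apply: leq_trans (ltnW lt) (lmin _ _) => x.
by rewrite vl /= lu' /= reflK.
Qed.

Lemma pos_or_neg_root (x : 'cV[R]_n) :
  Phi x -> pos_roots d A x \/ pos_roots d A (- x).
Proof.
move=> rx; case: (root_sign rx) => sx; [left | right]; split=> //=.
  exact: opp_root.
by move=> k; rewrite mxE oppr_ge0.
Qed.

(** * Fundamental roots in rank two *)

Lemma no_multiple_coord i (x : 'cV[R]_n) : (forall c, x <> c *: al i) ->
  exists2 k, k != i & x k 0 != 0.
Proof.
move=> xi; have [//|none] := pselect (exists2 k, k != i & x k 0 != 0).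
case: (xi (x i 0)); apply/colP => k; rewrite !mxE eqxx andbT.
have [->|ki] := eqVneq k i; first by rewrite mulr1.
by rewrite mulr0; apply/eqP/negPn/negP => xk; apply: none; exists k.
Qed.

(** The reflection changes only the coordinate [i], and another coordinate of
    [x] is positive. *)
Lemma refl_pos_root i (x : 'cV[R]_n) : pos_roots d A x ->
  (forall c, x <> c *: al i) -> pos_roots d A (s i *m x).
Proof.
case=> rx /= x0 xi; have rsx := refl_root i rx.
split=> //; case: (root_sign rsx) => [//|sx0].
have [k ki] := no_multiple_coord xi.
have := sx0 k; rewrite refl_other_coord // => xk0.
by rewrite eq_le xk0 x0.
Qed.

Lemma corootE i (x : 'cV[R]_n) : coroot i x = \sum_k (A i k)%:~R * x k 0.
Proof.
rewrite bformZl /bform /simple_root trmx_delta -rowE mxE big_distrr /=.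
by apply: eq_bigr => k _; rewrite !mxE !mulrA mulVf ?mul1r ?d_neq0.
Qed.

Lemma root_coord_int (x : 'cV[R]_n) k : Phi x -> x k 0 \is a Num.int.
Proof.
case/rootsP => u [i ->]; elim/last_ind: u k => [|u l IH] k.
  by rewrite mxE natr_int.
rewrite app_rcons reflE !mxE rpredB ?rpredM ?natr_int //.
by rewrite corootE rpred_sum // => m _; rewrite rpredM ?intr_int.
Qed.

Lemma pos_root_coord_nat (x : 'cV[R]_n) k : pos_roots d A x ->
  exists a : nat, x k 0 = a%:R.
Proof.
case=> rx x0; apply/natrP.
by rewrite natrEint root_coord_int //; exact: x0.
Qed.

Lemma root_norm (x : 'cV[R]_n) :
  Phi x -> exists i, bform d A x x = 2 * (d i)%:R.
Proof.
case/rootsP => u [i ->]; exists i; rewrite app_bform bform_simple.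
by case: hA => _ -> _ _; rewrite mulrC.
Qed.

Lemma dim_span_pair (x y : 'cV[R]_n) :
  y != 0 -> (forall c, x <> c *: y) -> \dim <<[:: x; y]>> = 2%N.
Proof.
move=> y0 xy; suff: free [:: x; y] by rewrite /free => /eqP.
rewrite free_cons span_seq1 seq1_free y0 andbT.
by apply/vlineP => -[c]; exact: xy.
Qed.

Lemma mem_span_pair (x y z : 'cV[R]_n) :
  z \in <<[:: x; y]>>%VS -> exists a b : R, z = a *: x + b *: y.
Proof.
rewrite span_cons span_seq1 => /memv_addP[_ /vlineP[a ->]].
by case=> _ /vlineP[b ->] ->; exists a, b.
Qed.

Lemma plane_decomposition (U : {vspace 'cV[R]_n}) j k (x y : 'cV[R]_n) :
  \dim U = 2%N -> al j \in U -> y \in U -> x \in U -> k != j -> y k 0 != 0 ->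
  x = (x k 0 / y k 0) *: y + (x j 0 - x k 0 / y k 0 * y j 0) *: al j.
Proof.
move=> dimU jU yU xU kj yk.
have dim2 : \dim <<[:: y; al j]>> = 2%N.
  apply: dim_span_pair; first exact: simple_root_neq0.
  by move=> c e; move: yk; rewrite e !mxE (negbTE kj) mulr0 eqxx.
have eU : <<[:: y; al j]>>%VS = U.
  apply/eqP; rewrite eqEdim dim2 dimU leqnn andbT.
  by apply/span_subvP => z; rewrite !inE => /orP[]/eqP->.
move: xU; rewrite -eU => /mem_span_pair[a [b ->]].
rewrite !mxE (negbTE kj) !eqxx /= mulr1 mulr0 addr0 mulfK //.
by rewrite [a * _ + b]addrC addrK.
Qed.

(** The angle between [x] and [y] is not acute, so the cross term of the norm
    is nonnegative. *)
Lemma bform_ge_leading (x y : 'cV[R]_n) (p q : R) :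
  0 <= p -> 0 <= q -> bform d A x y <= 0 -> 0 <= bform d A y y ->
  p ^+ 2 * bform d A x x <= bform d A (p *: x - q *: y) (p *: x - q *: y).
Proof.
move=> p0 q0 xy yy; rewrite -scaleNr !bformDl !bformDr !bformZl !bformZr.
rewrite (bformC y x).
have : 0 <= q ^+ 2 * bform d A y y by rewrite mulr_ge0 ?sqr_ge0.
have : p * q * bform d A x y <= 0 by rewrite mulr_ge0_le0 ?mulr_ge0.
by lra.
Qed.

(** Comparing the fractions [b / a] with [0 < a <= B] amounts to comparing the
    natural numbers [B! * b / a]; this lets a smallest fraction be chosen by
    minimizing a natural number. *)
Lemma slope_le_of_measure (B a1 b1 a2 b2 : nat) :
  (0 < a1 <= B)%N -> (0 < a2 <= B)%N ->
  (B`! %/ a1 * b1 <= B`! %/ a2 * b2)%N -> (b1 * a2 <= b2 * a1)%N.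
Proof.
move=> a1B a2B le.
have d1 : (a1 %| B`!)%N by apply: dvdn_fact.
have d2 : (a2 %| B`!)%N by apply: dvdn_fact.
rewrite -(leq_pmul2l (fact_gt0 B)).
have -> : (B`! * (b1 * a2) = B`! %/ a1 * b1 * (a1 * a2))%N.
  by rewrite -{1}(divnK d1); ring.
have -> : (B`! * (b2 * a1) = B`! %/ a2 * b2 * (a1 * a2))%N.
  by rewrite -{1}(divnK d2); ring.
by rewrite leq_mul2r le orbT.
Qed.

(** The root norms [2 * d i] are bounded, so [bform_ge_leading] bounds [p]. *)
Lemma coord_bound_below (y x : 'cV[R]_n) j k p q : pos_roots d A y ->
  bform d A y (al j) <= 0 -> Phi x -> 0 <= p -> 0 <= q ->
  x = p *: y - q *: al j ->
  x k 0 <= (\sum_i (d i)%:R) * y k 0.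
Proof.
move=> [ry y0] yj rx p0 q0 ex; set D : R := \sum_i _.
have dD i : (d i)%:R <= D.
  by rewrite /D (bigD1 i) //= lerDl sumr_ge0 // => l _; rewrite ler0n.
have d1 i : 1 <= (d i)%:R :> R by rewrite ler1n; case: hA.
have [i ei] := root_norm rx; have [l el] := root_norm ry.
have jj : 0 <= bform d A (al j) (al j).
  by have [m ->] := root_norm (simple_is_root j); rewrite mulr_ge0.
have := bform_ge_leading p0 q0 yj jj; rewrite -ex ei el => le_norm.
have p2 : p ^+ 2 <= D.
  have : p ^+ 2 * 1 <= p ^+ 2 * (d l)%:R by apply: ler_wpM2l; rewrite ?sqr_ge0.
  by have := dD i; lra.
have pD : p <= D.
  have [p1|p1] := leP p 1; first by apply: le_trans p1 (le_trans (d1 i) (dD i)).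
  by apply: le_trans p2; rewrite expr2 ler_peMl // ltW.
have -> : x k 0 = p * y k 0 - q * al j k 0 by rewrite ex !mxE.
have qk : 0 <= q * al j k 0 by rewrite mulr_ge0 // simple_ge0.
have : p * y k 0 <= D * y k 0 by apply: ler_wpM2r; first exact: y0.
by lra.
Qed.

(** The other fundamental root is a root of smallest slope [x j 0 / x k 0],
    where [k] is a second coordinate on the plane.  The infimum of the slopes
    is attained: starting from a root [y0] at a non-acute angle with [al j], the
    roots of slope at most that of [y0] have bounded coordinate [k] by
    [coord_bound_below], and their coordinates are natural numbers. *)
Lemma simple_fundamental (S : set 'cV[R]_n) j :
  rank_two_subsystem d A S -> S (al j) -> fundamental_root d A S (al j).
Proof.
case=> U [[SU minU] dimU eS] Sj.
have jU : al j \in U by exact: SU.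
have inS x : Phi x -> x \in U -> S x by move=> ? ?; rewrite eS; split.
have rootS x : S x -> Phi x by rewrite eS => -[].
have [y [Sy py yj]] : exists y, [/\ S y, pos_roots d A y &
    forall c, y <> c *: al j].
  apply: contrapT => none.
  have : (U <= <[al j]>)%VS.
    apply: minU => x Sx; apply: contrapT => xj; apply: none.
    have nx c : x <> c *: al j by move=> e; apply: xj; apply/vlineP; exists c.
    have [px|px] := pos_or_neg_root (rootS x Sx); first by exists x.
    exists (- x); split=> //; last first.
      by move=> c e; apply: (nx (- c)); rewrite scaleNr -e opprK.
    apply: inS; rewrite ?rpredN ?(SU x) //.
    by apply: opp_root => //; exact: rootS.
  move/dimvS; rewrite dimU dim_vline simple_root_neq0 //=.
(* Replacing [y] by its reflection changes the sign of its product with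
   [al j]. *)
have [y0 [Sy0 py0 y0j neg]] : exists y, [/\ S y, pos_roots d A y,
    forall c, y <> c *: al j & bform d A y (al j) <= 0].
  have [le0|gt0] := leP (bform d A y (al j)) 0; first by exists y.
  have jy : bform d A (s j *m y) (al j) = - bform d A y (al j).
    rewrite -[in LHS](opprK (al j)) -refl_simple.
    by rewrite -scaleN1r bformZr bform_refl mulN1r.
  exists (s j *m y); split.
  - apply: inS; first by apply: refl_root => //; exact: rootS.
    by rewrite reflE rpredB ?rpredZ ?SU.
  - exact: refl_pos_root.
  - move=> c e; apply: (yj (- c)).
    by rewrite -[y](reflK j) e -scalemxAr refl_simple scalerN scaleNr.
  - by rewrite jy oppr_le0 ltW.
have [k kj y0k] := no_multiple_coord y0j.
have y0k_gt0 : 0 < y0 k 0.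
  by rewrite lt_neqAle eq_sym y0k; case: py0 => _; exact.
have [B eB] : exists B : nat, (\sum_i (d i)%:R) * y0 k 0 = B%:R.
  have [m ->] := pos_root_coord_nat k py0.
  by exists ((\sum_i d i) * m)%N; rewrite natrM natr_sum.
pose below (x : 'cV[R]_n) := [/\ S x, pos_roots d A x, 0 < x k 0 &
                    x j 0 * y0 k 0 <= x k 0 * y0 j 0].
pose slope (x : 'cV[R]_n) :=
  (B`! %/ Num.truncn (x k 0)%R * Num.truncn (x j 0)%R)%N.
have decomp (x y1 : 'cV[R]_n) : S x -> S y1 -> 0 < y1 k 0 ->
    x = (x k 0 / y1 k 0) *: y1 + (x j 0 - x k 0 / y1 k 0 * y1 j 0) *: al j.
  move=> Sx Sy1 y1k; apply: plane_decomposition dimU jU _ _ kj _.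
  - exact: SU.
  - exact: SU.
  - by rewrite gt_eqF.
have [|x1 [Sx1 px1 x1k x1y0] x1min] := @exists_min_measure _ slope below.
  by exists y0; split=> //; rewrite mulrC.
have coordB (x : 'cV[R]_n) : below x ->
    exists a : nat, x k 0 = a%:R /\ (0 < a <= B)%N.
  case=> Sx px xk xy0; have [a ea] := pos_root_coord_nat k px.
  exists a; split=> //; rewrite -(ltr0n R) -(ler_nat R) -ea xk /= -eB.
  have q0 : 0 <= x k 0 / y0 k 0 * y0 j 0 - x j 0.
    by rewrite subr_ge0 mulrAC ler_pdivlMr.
  apply: coord_bound_below py0 neg (rootS x Sx) _ q0 _.
    exact: (divr_ge0 (ltW xk) (ltW y0k_gt0)).
  by rewrite -scaleNr opprB; exact: decomp.
have slope_min (x : 'cV[R]_n) : S x -> pos_roots d A x -> 0 < x k 0 ->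
    x1 j 0 * x k 0 <= x j 0 * x1 k 0.
  move=> Sx px xk.
  have [le|/ltW gt] := leP (x j 0 * y0 k 0) (x k 0 * y0 j 0); last first.
    rewrite -(ler_pM2r y0k_gt0).
    have : x1 j 0 * y0 k 0 * x k 0 <= x1 k 0 * y0 j 0 * x k 0.
      by apply: ler_wpM2r => //; exact: ltW.
    have : x k 0 * y0 j 0 * x1 k 0 <= x j 0 * y0 k 0 * x1 k 0.
      by apply: ler_wpM2r => //; exact: ltW.
    by lra.
  have [a1 [e1 B1]] := coordB x1 (And4 Sx1 px1 x1k x1y0).
  have [a [e2 B2]] := coordB x (And4 Sx px xk le).
  have [b1 f1] := pos_root_coord_nat j px1.
  have [b f2] := pos_root_coord_nat j px.
  have := x1min x (And4 Sx px xk le).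
  rewrite /slope e1 e2 f1 f2 !Num.Theory.natrK => /(slope_le_of_measure B1 B2).
  by rewrite -!natrM ler_nat.
exists (al j), x1; split; last by left.
split=> // [|x [Sx px]].
  by split=> //; split; [exact: simple_is_root | exact: simple_ge0].
exists (x j 0 - x k 0 / x1 k 0 * x1 j 0), (x k 0 / x1 k 0); split.
- have [_ x0] := px.
  have := x0 k; rewrite le_eqVlt => /orP[/eqP<-|xk].
    by rewrite !mul0r subr0.
  by rewrite subr_ge0 mulrAC ler_pdivrMr // mulrC slope_min.
- by case: px => _ x0; rewrite divr_ge0 ?x0 // ltW.
- by rewrite addrC; exact: decomp.
Qed.

Lemma simple_not_cut (S : set 'cV[R]_n) j : ~ cuts d A S (al j).
Proof. by case=> rS Sj; apply; exact: simple_fundamental. Qed.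

(** * Cuts along a positive expression *)

Lemma pairing_refl i (theta : 'rV[R]_n) x :
  pairing (theta *m s i) x = pairing theta (s i *m x).
Proof. by rewrite /pairing mulmxA. Qed.

Lemma rank_two_refl i (S : set 'cV[R]_n) : rank_two_subsystem d A S ->
  rank_two_subsystem d A [set x | S (s i *m x)].
Proof.
case=> U [[SU minU] dimU eS].
pose f : 'End('cV[R]_n) := linfun (mulmx (s i)).
have fE x : f x = s i *m x by rewrite lfunE.
have ffK x : f (f x) = x by rewrite !fE reflK.
have mem_fU (V : {vspace 'cV[R]_n}) x : (x \in (f @: V)%VS) = (s i *m x \in V).
  apply/memv_imgP/idP => [[y yV ->]|xV].
    by rewrite -fE ffK.
  by exists (s i *m x) => //; rewrite -fE ffK.
exists (f @: U)%VS; split; first split.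
- by move=> x Sx; rewrite mem_fU; exact: SU.
- move=> V SV; have UV : (U <= f @: V)%VS.
    by apply: minU => x Sx; rewrite mem_fU; apply: SV; rewrite /= reflK.
  by apply/subvP => x; rewrite mem_fU => /(subvP UV); rewrite mem_fU reflK.
- rewrite limg_dim_eq //; apply/eqP; rewrite -subv0; apply/subvP => x.
  rewrite memv_cap memv_ker => /andP[_ /eqP fx].
  by rewrite -[x]ffK fx linear0 mem0v.
- apply/seteqP; split=> x /=; rewrite eS mem_fU /= => -[rx xU]; split=> //.
    by rewrite -[x](reflK i); exact: refl_root.
  exact: refl_root.
Qed.

(** Without [al i], the subsystem contains no multiple of [al i], so the
    reflection maps its positive roots to positive roots, in both
    directions. *)
Lemma fundamental_root_refl i (S : set 'cV[R]_n) x :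
  rank_two_subsystem d A S -> ~ S (al i) ->
  fundamental_root d A [set y | S (s i *m y)] (s i *m x) ->
  fundamental_root d A S x.
Proof.
case=> U [_ _ eS] nSi.
have keep b : Phi b -> b \in U -> forall c, b <> c *: al i.
  move=> rb bU c e; apply: nSi; rewrite eS; split; first exact: simple_is_root.
  have c0 : c != 0.
    by apply: contraNneq (root_neq0 rb) => c0; rewrite e c0 scale0r.
  by rewrite /= -[al i](scalerK c0) -e rpredZ.
have move_in b : (S `&` pos_roots d A) b ->
    ([set y | S (s i *m y)] `&` pos_roots d A) (s i *m b).
  case=> Sb pb; split; first by rewrite /= reflK.
  by apply: refl_pos_root => //; move: Sb; rewrite eS => -[rb bU]; exact: keep.
have move_out b : ([set y | S (s i *m y)] `&` pos_roots d A) b ->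
    (S `&` pos_roots d A) (s i *m b).
  case=> /= Sb pb; split=> //; apply: refl_pos_root => // c e.
  move: Sb; rewrite eS => -[rb bU]; apply: (keep _ rb bU (- c)).
  by rewrite e -scalemxAr refl_simple // scalerN scaleNr.
case=> b1 [b2 [[/move_out h1 /move_out h2 pair] xb]].
exists (s i *m b1), (s i *m b2); split.
  split=> // y /move_in /pair[c1 [c2 [? ? e]]]; exists c1, c2; split=> //.
  by rewrite -[y](reflK i) e mulmxDr -!scalemxAr.
by case: xb => <-; rewrite reflK //; [left | right].
Qed.

Lemma cuts_refl i (S : set 'cV[R]_n) x : ~ S (al i) -> cuts d A S x ->
  cuts d A [set y | S (s i *m y)] (s i *m x).
Proof.
move=> nSi [rS Sx nfx]; split; first exact: rank_two_refl.
  by rewrite /= reflK.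
by move=> fx; apply: nfx; apply: fundamental_root_refl fx.
Qed.

(** A simple root spans an extreme ray of the cone of nonnegative vectors. *)
Lemma nonneg_scale_of_sum i (x y : 'cV[R]_n) p q :
  pos_roots d A x -> pos_roots d A y -> 0 <= p -> 0 < q ->
  al i = p *: x + q *: y -> exists c, y = c *: al i.
Proof.
move=> [_ /= x0] [_ /= y0] p0 q0 e; apply: contrapT => ny.
have [|k ki yk] := @no_multiple_coord i y.
  by move=> c yc; apply: ny; exists c.
have := congr1 (fun z : 'cV[R]_n => z k 0) e.
rewrite !mxE (negbTE ki) /= => /esym/eqP.
rewrite paddr_eq0 ?mulr_ge0 ?x0 ?y0 ?(ltW q0) // => /andP[_].
by rewrite mulf_eq0 (negbTE yk) orbF gt_eqF.
Qed.

Lemma fundamental_pairC S b1 b2 :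
  fundamental_pair d A S b1 b2 -> @fundamental_pair R n d A S b2 b1.
Proof.
case=> h1 h2 pair; split=> // x /pair[c1 [c2 [? ? ->]]].
by exists c2, c1; split=> //; rewrite addrC.
Qed.

(** If [y] were fundamental, the other fundamental root would be a positive
    multiple of [al i]; then [x = y - c *: al i] would have a negative
    coefficient. *)
Lemma span_cuts i c (x y : 'cV[R]_n) : pos_roots d A x -> pos_roots d A y ->
  0 < c -> y = x + c *: al i -> (forall c', x <> c' *: al i) ->
  cuts d A (Phi `&` [set z | z \in <<[:: x; al i]>>%VS]) y.
Proof.
move=> px py c0 ey nx; set S := _ `&` _.
have iU : al i \in <<[:: x; al i]>>%VS by rewrite memv_span // !inE eqxx orbT.
have xU : x \in <<[:: x; al i]>>%VS by rewrite memv_span // !inE eqxx.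
have yU : y \in <<[:: x; al i]>>%VS by rewrite ey rpredD ?rpredZ.
have Si : S (al i) by split=> //; exact: simple_is_root.
have Sx : S x by split=> //; case: px.
have ny c' : y <> c' *: al i.
  move=> e; apply: (nx (c' - c)).
  by rewrite scalerBl -e ey addrK.
split.
- exists <<[:: x; al i]>>%VS; split=> //.
    split=> [z []//|V SV]; apply/span_subvP => z.
    by rewrite !inE => /orP[]/eqP->; exact: SV.
  by apply: dim_span_pair => //; exact: simple_root_neq0.
- by split=> //; case: py.
have absurd b : ~ fundamental_pair d A S b y.
  case=> -[_ pb] _ pair.
  have [p [q [p0 q0 ei]]] : exists c1 c2 : R,
      [/\ 0 <= c1, 0 <= c2 & al i = c1 *: b + c2 *: y].
    apply: pair; split=> //.
    by split; [exact: simple_is_root | exact: simple_ge0].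
  have [q_eq0|q_neq0] := eqVneq q 0; last first.
    have [|c' e] := nonneg_scale_of_sum pb py p0 _ ei.
      by rewrite lt_neqAle eq_sym q_neq0.
    exact: ny e.
  have [t [u [t0 u0 ex]]] : exists c1 c2 : R,
      [/\ 0 <= c1, 0 <= c2 & x = c1 *: b + c2 *: y] by exact: pair.
  have p_neq0 : p != 0.
    apply: contraNneq (simple_root_neq0 i) => p_eq0.
    by rewrite ei p_eq0 q_eq0 !scale0r addr0.
  have eb : b = p^-1 *: al i by rewrite ei q_eq0 scale0r addr0 scalerK.
  have [u1|u1] := eqVneq u 1.
    have : (t / p + c) *: al i = 0.
      have := ex; rewrite u1 scale1r ey eb scalerA addrCA -scalerDl.
      by rewrite -[X in X = _]addr0 => /addrI <-.
    move/eqP; rewrite scaler_eq0 (negbTE (simple_root_neq0 i)) orbF.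
    rewrite gt_eqF // ltr_wpDl // divr_ge0 //.
  apply: (nx ((1 - u)^-1 * (t / p + u * c))).
  rewrite -scalerA; apply/(canRL (scalerK _)); first by rewrite subr_eq0 eq_sym.
  rewrite scalerBl scale1r; apply/eqP; rewrite subr_eq; apply/eqP.
  rewrite {1}ex eb ey scalerA scalerDr scalerA scalerDl -addrA.
  by congr (_ + _); rewrite addrC.
case=> b1 [b2 [fp [e|e]]]; last by apply: (absurd b1); rewrite e.
by apply: (absurd b2); apply: fundamental_pairC; rewrite e.
Qed.

(** The union of the relative interiors of the shards of [perp x]. *)
Definition shard_interior (x : 'cV[R]_n) : set 'rV[R]_n :=
  perp x `\` \bigcup_(S in [set S | cuts d A S x]) set_perp S.

Lemma shard_interior_simple j : shard_interior (al j) = perp (al j).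
Proof.
apply/seteqP; split=> [theta []//|theta ht]; split=> // -[S /= cS _].
exact: simple_not_cut cS.
Qed.

(** Cutting subsystems without [al i] correspond under the reflection; those
    with [al i] impose that [al i] does not vanish. *)
Lemma shard_interior_refl i c (x : 'cV[R]_n) theta :
  pos_roots d A x -> pos_roots d A (s i *m x) -> 0 < c ->
  s i *m x = x + c *: al i -> (forall c', x <> c' *: al i) ->
  shard_interior (s i *m x) theta <->
  shard_interior x (theta *m s i) /\ pairing theta (s i *m al i) <> 0.
Proof.
move=> px py c0 ey nx; rewrite refl_simple //.
have pN := pairingNr theta (al i).
split=> [[ht nt]|[[ht nt] ti]].
  have ti : pairing theta (al i) <> 0.
    move=> ti; apply: nt; exists (Phi `&` [set z | z \in <<[:: x; al i]>>%VS]).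
      exact: span_cuts ey nx.
    move=> z [_ /= /mem_span_pair[a [b ->]]].
    have tx : pairing theta x = 0.
      have := ht; rewrite /perp /= ey pairingDr pairingZr ti mulr0 addr0.
      exact.
    by rewrite pairingDr !pairingZr tx ti !mulr0 addr0.
  split; last by rewrite pN => /eqP; rewrite oppr_eq0 => /eqP.
  split; first by rewrite /perp /= pairing_refl.
  case=> S /= cS tS; apply: nt.
  have nSi : ~ S (al i).
    move/tS; rewrite pairing_refl refl_simple // pN => /eqP.
    by rewrite oppr_eq0 => /eqP.
  exists [set y | S (s i *m y)]; first exact: cuts_refl.
  by move=> z /= Sz; have := tS _ Sz; rewrite pairing_refl reflK.
split; first by move: ht; rewrite /perp /= pairing_refl.
case=> S /= cS tS; apply: nt.
have nSi : ~ S (al i) by move/tS => e; apply: ti; rewrite pN e oppr0.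
exists [set y | S (s i *m y)].
  by have := cuts_refl nSi cS; rewrite reflK.
by move=> z /= Sz; rewrite pairing_refl; exact: tS.
Qed.

(** * Cones along a positive expression *)

(** The normal of the hyperplane introduced at a letter [i], transported by the
    letters that follow.  The letter itself is applied too, because [sigma]
    intersects with the half space before it reflects. *)
Fixpoint wall_normals (w : seq 'I_n) : seq 'cV[R]_n :=
  if w is i :: w' then app w (al i) :: wall_normals w' else [::].

Lemma size_wall_normals w : size (wall_normals w) = size w.
Proof. by elim: w => //= i w ->. Qed.

Lemma wall_normals_rcons w i :
  wall_normals (rcons w i) =
  [seq s i *m f | f <- rcons (wall_normals w) (al i)].
Proof.
elim: w => //= l w ->; congr (_ :: _).
by rewrite app_rcons.
Qed.

Lemma sigma_closed_cone e i x (G : seq 'cV[R]_n) :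
  sigma d A e i (closed_cone x G) =
  closed_cone (s i *m x)
    [seq s i *m g | g <- (if e then al i else - al i) :: G].
Proof.
have refl2 (eta : 'rV[R]_n) : eta *m s i *m s i = eta.
  by rewrite -mulmxA refl_mul_refl mulmx1.
have half theta : half_space e i (theta *m s i) <->
    0 <= pairing theta (s i *m (if e then al i else - al i)).
  rewrite /half_space /=; case: e; first by rewrite pairing_refl.
  by rewrite pairing_refl mulmxN pairingNr oppr_ge0.
apply/seteqP; split=> theta.
  rewrite /sigma /dual_act invmx_refl.
  case=> eta [[ex eG] he] <-; split.
    by rewrite /perp /= pairing_refl reflK.
  rewrite /= => f; rewrite inE => /orP[/eqP ->|].
    by apply/half; rewrite refl2.
  by case/mapP => g gG ->; rewrite pairing_refl reflK; exact: eG.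
case=> tx tG; exists (theta *m s i); last first.
  by rewrite /dual_act invmx_refl refl2.
split; last by apply/half/tG; rewrite mem_head.
split; first by rewrite /perp /= pairing_refl.
move=> g gG; rewrite pairing_refl; apply: tG.
by rewrite /= inE map_f ?orbT.
Qed.

Lemma sigmas_closed_cone w es x (G : seq 'cV[R]_n) : size es = size w ->
  sigmas d A w es (closed_cone x G) =
  closed_cone (app w x) (map (app w) G ++ signed es (wall_normals w)).
Proof.
elim: w es x G => [|i w IH] [|e es] x G //= => [_|[sz]].
  by rewrite map_id cats0.
rewrite /sigmas /= -/(sigmas d A w es _) sigma_closed_cone IH //.
rewrite !map_cons -map_comp.
have -> : s i *m (if e then al i else - al i) =
    if e then s i *m al i else - (s i *m al i) by case: e; rewrite ?mulmxN.
have eq_normal : app w (if e then s i *m al i else - (s i *m al i)) =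
    if e then app w (s i *m al i) else - app w (s i *m al i).
  by case: e; rewrite ?appN.
have -> : signed (e :: es) (app w (s i *m al i) :: wall_normals w) =
    app w (if e then s i *m al i else - (s i *m al i)) ::
      signed es (wall_normals w).
  by rewrite eq_normal.
by apply/seteqP; split=> theta [tx tG]; split=> // f; move: (tG f);
  rewrite !(mem_cat, inE) orbCA orbA.
Qed.

Lemma sigmas_perp w es x : size es = size w ->
  sigmas d A w es (perp x) = closed_cone (app w x) (signed es (wall_normals w)).
Proof.
move=> sz; rewrite -(sigmas_closed_cone x [::] sz); congr (sigmas _ _ _ _ _).
by apply/seteqP; split=> theta => [tx|[]//]; split.
Qed.

Lemma positive_expression_rcons x w i j :
  positive_expression d A x (rcons w i) j ->
  [/\ positive_expression d A (app w (al j)) w j, x = s i *m app w (al j) &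
      exists2 c : R, 0 < c & x = app w (al j) + c *: al i].
Proof.
case=> ex pos; split; last 1 first.
- have [|c c0] := pos (size w); first by rewrite size_rcons.
  rewrite take_oversize ?size_rcons // -ex -cats1 take_size_cat //.
  rewrite nth_cat ltnn subnn /= => e; exists c => //.
  by rewrite -e addrC subrK.
- split=> // k kw; have [|c c0] := pos k.
    by rewrite size_rcons ltnW.
  rewrite -cats1 !takel_cat ?(ltnW kw) // nth_cat kw => e.
  by exists c.
- by rewrite ex app_rcons.
Qed.

(** Induction on the expression.  At each step [x] is not a multiple of [al i]:
    otherwise [refl i] would map it to [- x], which is not positive. *)
Lemma positive_expression_walls x w j : positive_expression d A x w j ->
  [/\ pos_roots d A x,
      forall f c, f \in wall_normals w -> f <> c *: x &
      shard_interior x = arrangement_complement x (wall_normals w)].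
Proof.
elim/last_ind: w x => [|w i IH] y.
  case=> /= -> _; split=> //.
    by split; [exact: simple_is_root | exact: simple_ge0].
  rewrite shard_interior_simple.
  by apply/seteqP; split=> theta => [tx|[]//]; split.
case/positive_expression_rcons => /IH[]; set x := app w (al j).
move=> px nw ix ey [c c0 eyc].
have rx : Phi x by case: px.
have py : pos_roots d A y.
  split; first by rewrite ey; exact: refl_root.
  move=> k; case: px => _ x0.
  by rewrite eyc !mxE addr_ge0 ?x0 // mulr_ge0 ?ler0n // ltW.
have nx c' : x <> c' *: al i.
  move=> ex; have yx : y = - x by rewrite ey ex -scalemxAr refl_simple scalerN.
  have := root_neq0 rx; case/negP; apply/eqP/colP => k; rewrite [RHS]mxE.
  apply/eqP; rewrite eq_le; case: px py => _ x0 [_ y0].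
  by rewrite x0 -oppr_ge0 andbT; have := y0 k; rewrite yx mxE.
have inj f c' : s i *m f = c' *: y -> f = c' *: x.
  by rewrite ey => e; rewrite -[f](reflK i) e -scalemxAr reflK.
split=> //.
  move=> f c'; rewrite wall_normals_rcons => /mapP[g gw ->] /inj e.
  move: gw; rewrite mem_rcons inE => /orP[/eqP gi|gw]; last exact: nw gw e.
  have c'0 : c' != 0.
    by apply: contraNneq (simple_root_neq0 i) => c'0; rewrite -gi e c'0 scale0r.
  by apply: (nx c'^-1); rewrite -gi e scalerK.
have step theta : shard_interior y theta <->
    shard_interior x (theta *m s i) /\ pairing theta (s i *m al i) <> 0.
  by rewrite ey; apply: (@shard_interior_refl i c); rewrite -?ey.
apply/seteqP; split=> theta.
  case/step; rewrite ix => -[tx tw] ti; split.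
    by rewrite /perp /= ey -pairing_refl.
  move=> f; rewrite wall_normals_rcons => /mapP[g gw ->].
  move: gw; rewrite mem_rcons inE => /orP[/eqP ->|/tw]; first exact/eqP.
  by rewrite pairing_refl.
case=> ty tw; apply/step; rewrite ix; split; last first.
  apply/eqP/tw; rewrite wall_normals_rcons map_f // mem_rcons mem_head //.
split; first by rewrite /perp /= pairing_refl -ey.
move=> f fw; rewrite pairing_refl; apply: tw.
by rewrite wall_normals_rcons map_f // mem_rcons inE fw orbT.
Qed.
End RootSystem.

Theorem theorem3p6 (R : realType) (n : nat) (d : 'I_n -> nat) (A : 'M[int]_n)
    (hA : sym_cartan d A) (beta : 'cV[R]_n) (hbeta : pos_roots d A beta)
    (r : nat) (w : r.-tuple 'I_n) (j : 'I_n)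
    (hw : positive_expression d A beta w j) :
  shards d A beta =
  [set K | span_dim K n.-1 /\
     exists es : r.-tuple bool, K = sigmas d A w es (perp (simple_root R j))].
Proof.
have [_ nw interior] := positive_expression_walls hA hw.
have b0 : beta != 0 by case: hbeta => /(root_neq0 hA).
have eb : beta = apply_refls d A w (simple_root R j) by case: hw.
have ew : size (wall_normals R d A w) = r.
  by rewrite size_wall_normals size_tuple.
rewrite /shards -/(shard_interior d A beta) interior.
case: n => [|n] in d A hA beta hbeta w j hw nw interior b0 eb ew *.
  by have := ltn_ord j.
rewrite arrangement_component_closures //.
apply/seteqP; split=> K [spanK].
  case=> es; rewrite ew => sz eK; split=> //.
  by exists (Tuple (introT eqP sz)); rewrite sigmas_perp ?size_tuple // -eb.
case=> es eK; split=> //.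
exists es; first by rewrite ew size_tuple.
by rewrite eK sigmas_perp ?size_tuple // -eb.
Qed.
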